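(* Let $f\in\mathbb{Q}^2$ and let $R=\{r^1,\dots,r^k\}\subset\mathbb{Q}^2\setminus\{0\}$. There exists a finite subset $\Xi_0\subseteq\Pi$ such that for every $\gamma\in\Pi\setminus\Xi_0$ there exist $\gamma^1,\gamma^2\in\Delta$ such that $\gamma$ is a strict convex combination of $\gamma^1$ and $\gamma^2$. Moreover, the cardinality of $\Xi_0$ is bounded polynomially in the binary encoding sizes of $f,r^1,\dots,r^k$. Specifically, $\Xi_0$ can be chosen as the set of all $\gamma(B)$ such that $B\in\mathbb{R}^{3\times 2}$, $M(B)$ is a maximal lattice-free split, and one of the following holds: Case a. $P(B,R)\subset\mathbb{Z}^2$. Case b. There exists $j\in\{1,\dots,k\}$ such that $r^j$ lies in the recession cone of the split $M(B)$. Case c. $\#(\operatorname{conv}(P(B,R)\cap F_1(B))\cap\mathbb{Z}^2)\ge 2$.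
   Context: For $B\in\mathbb{R}^{n\times 2}$ with rows $b^1,\dots,b^n$: $M(B)=\{x\in\mathbb{R}^2 : b^i\cdot(x-f)\le 1,\ i=1,\dots,n\}$ (so $f\in\operatorname{int}M(B)$), $F_i(B)=M(B)\cap\{x: b^i\cdot(x-f)=1\}$, $\psi_B(r)=\max_i b^i\cdot r$, $\gamma(B)=(\psi_B(r^j))_{j=1}^k$, and $P(B,R)=\{f+\tfrac{1}{\psi_B(r)}r : r\in R,\ \psi_B(r)>0\}$ is the set of ray intersections. A convex set in $\mathbb{R}^2$ is lattice-free if its interior contains no point of $\mathbb{Z}^2$; it is maximal lattice-free if inclusion-maximal among lattice-free convex sets. A maximal lattice-free split in $\mathbb{R}^2$ is a set $\{x: c\le a x_1+b x_2\le c+1\}$ with $a,b$ coprime integers and $c$ an integer; when written as $M(B)$ with $B\in\mathbb{R}^{3\times 2}$, a redundant description with three inequalities is used, and the order of the rows of $B$ is arbitrary. $\Delta=\{\gamma(B): B\in\mathbb{R}^{3\times 2},\ M(B)\text{ lattice-free (not necessarily maximal)}\}$ and $\Pi=\{\gamma(B): B\in\mathbb{R}^{3\times2},\ M(B)\text{ is a maximal lattice-free split}\}$. A point $x$ is a strict convex combination of $y^1$ and $y^2$ if $y^1\ne y^2$ and $x=\tfrac12(y^1+y^2)$. $\#$ denotes cardinality. ''Bounded polynomially'' means bounded by a fixed polynomial, independent of the data, in the total encoding size. *)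

(* Defs.v *)
From HB Require Import structures.
From mathcomp Require Export all_boot all_order all_algebra.
From mathcomp Require Export all_classical all_reals all_analysis.
Export numFieldNormedType.Exports.
Export Order.TTheory GRing.Theory Num.Theory.

Set Implicit Arguments.
Unset Strict Implicit.
Unset Printing Implicit Defensive.

Local Open Scope classical_set_scope.
Local Open Scope card_scope.
Local Open Scope ring_scope.

Section Geometry.
Context {R : realType}.
Implicit Types (u v x f : 'rV[R]_2) (C S : set 'rV[R]_2).

Definition dot u v : R := \sum_(i < 2) u 0 i * v 0 i.

Definition Z2 : set 'rV[R]_2 := [set x | x \is a mxOver Num.int].

Definition lattice_free C := convex_set C /\ C° `&` Z2 = set0.

Definition maximal_lattice_free_split S := exists a b c : int,
  coprimez a b /\
  S = [set x | c%:~R <= a%:~R * x 0 ord0 + b%:~R * x 0 ord_max <= c%:~R + 1].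

Definition conv_hull S : set 'rV[R]_2 := smallest (@convex_set R 'rV[R]_2) S.

Definition recession_cone C : set 'rV[R]_2 :=
  [set d | forall x (t : R), C x -> 0 <= t -> C (x + t *: d)].

Definition strict_convex_combination (V : lmodType R) (x y1 y2 : V) :=
  y1 <> y2 /\ x = 2^-1 *: (y1 + y2).

Definition polyM f n (B : 'M[R]_(n, 2)) : set 'rV[R]_2 :=
  [set x | forall i, dot (row i B) (x - f) <= 1].

Definition polyF f n (B : 'M[R]_(n, 2)) (i : 'I_n) : set 'rV[R]_2 :=
  polyM f B `&` [set x | dot (row i B) (x - f) = 1].

(* The seed of the iterated maximum is one of its terms, so that this is the
   true maximum, including when all the values are negative. *)
Definition psi n (B : 'M[R]_(n.+1, 2)) (r : 'rV[R]_2) : R :=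
  \big[Num.max/dot (row ord0 B) r]_(i < n.+1) dot (row i B) r.

Section Rays.
Variables (f : 'rV[R]_2) (k : nat) (r : 'I_k -> 'rV[R]_2).

Definition gamma n (B : 'M[R]_(n.+1, 2)) : 'rV[R]_k :=
  \row_j psi B (r j).

Definition ray_points n (B : 'M[R]_(n.+1, 2)) : set 'rV[R]_2 :=
  [set f + (psi B (r j))^-1 *: r j | j in [set j | 0 < psi B (r j)]].

Definition Delta : set 'rV[R]_k :=
  [set gamma B | B in [set B : 'M[R]_(3, 2) | lattice_free (polyM f B)]].

Definition split_matrices : set 'M[R]_(3, 2) :=
  [set B | maximal_lattice_free_split (polyM f B)].

Definition Pi : set 'rV[R]_k := [set gamma B | B in split_matrices].

Definition case_a (B : 'M[R]_(3, 2)) := ray_points B `<=` Z2.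

Definition case_b (B : 'M[R]_(3, 2)) :=
  exists j, recession_cone (polyM f B) (r j).

(* The rows of [B] come in arbitrary order, so facet [ord0] can be either side
   of the split, or empty when row [ord0] is strictly redundant. *)
Definition case_c (B : 'M[R]_(3, 2)) :=
  `I_2 #<= conv_hull (ray_points B `&` polyF f B ord0) `&` Z2.

Definition Xi0 : set 'rV[R]_k :=
  [set gamma B | B in
     split_matrices `&` [set B | [\/ case_a B, case_b B | case_c B]]].

End Rays.
End Geometry.

(* Binary encoding sizes, as in Schrijver, Theory of Linear and Integer
   Programming, Section 2.1; [up_log 2 m] is the ceiling of log_2 m. *)
Definition rat_size (q : rat) : nat :=
  (1 + up_log 2 `|numq q|%N.+1 + up_log 2 `|denq q|%N.+1)%N.

Definition vec_size (v : 'rV[rat]_2) : nat :=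
  (2 + \sum_(i < 2) rat_size (v ord0 i))%N.

Definition data_size (f : 'rV[rat]_2) k (r : 'I_k -> 'rV[rat]_2) : nat :=
  (vec_size f + \sum_(j < k) vec_size (r j))%N.

(* Main.v *)
(* Write a maximal lattice-free split as [c <= w.x <= c + 1] with [w]
   primitive. Its gauge is [max(w.r / (c + 1 - w.f), - w.r / (w.f - c))],
   whatever the redundant row of [B].

   Outside cases a, b and c, some side of the split, say [w.x = c + 1],
   contains a point of P(B,R) that is not a lattice point, and all its points
   of P(B,R) lie strictly between two lattice points [z - u] and [z + u],
   where [u] is [w] turned by a right angle. Rotating this side slightly about
   [z] in either direction changes the gauge on the rays hitting it by
   opposite amounts. The lattice points that the rotation uncovers are cut off
   by the third row, a larger rotation about [z - u] or [z + u].

   In case a the gauge is determined by the first lattice points on the rays,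
   and in case b the split is determined by [r j]. In case c the side is an
   edge of the integer hull of a cone [f + cone(s, t)]. Two lattice points
   [x], [x'] on distinct such edges cannot have cone coordinates within a
   factor 2 of each other: otherwise [2 x - x'] and [2 x' - x] lie in the
   cone, which forces both edges to be the same. Counting dyadic classes of
   the coordinates gives the polynomial bound. *)
Require Import Defs.
From mathcomp Require Import ring lra zify.

Set Implicit Arguments.
Unset Strict Implicit.
Unset Printing Implicit Defensive.

Local Open Scope classical_set_scope.
Local Open Scope card_scope.
Local Open Scope ring_scope.

(** * Coordinates, rotations and lattice points in the plane *)

Definition vec2 (T : Type) (x y : T) : 'rV[T]_2 :=
  \row_(i < 2) if i == ord0 then x else y.

Lemma vec2E (T : Type) (x y : T) :
  (vec2 x y 0 ord0 = x) * (vec2 x y 0 ord_max = y).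
Proof. by rewrite !mxE. Qed.

Lemma forall_ord2 (P : 'I_2 -> Prop) : P ord0 -> P ord_max -> forall i, P i.
Proof.
by move=> P0 P1 [[|[|//]] i2];
  [rewrite (_ : Ordinal _ = ord0)|rewrite (_ : Ordinal _ = ord_max)] => //;
  apply/val_inj.
Qed.

Lemma rV2P (T : Type) (u v : 'rV[T]_2) :
  u 0 ord0 = v 0 ord0 -> u 0 ord_max = v 0 ord_max -> u = v.
Proof. by move=> e0 e1; apply/rowP; apply: forall_ord2. Qed.

Section Plane.
Context {R : realType}.
Implicit Types (u v x y f r w : 'rV[R]_2).

Lemma dotE u v : dot u v = u 0 ord0 * v 0 ord0 + u 0 ord_max * v 0 ord_max.
Proof.
by rewrite /dot big_ord_recl big_ord1; congr (_ + u _ _ * v _ _);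
  apply/val_inj.
Qed.

Lemma dotDr u v x : dot u (v + x) = dot u v + dot u x.
Proof. by rewrite !dotE !mxE; ring. Qed.

Lemma dotBr u v x : dot u (v - x) = dot u v - dot u x.
Proof. by rewrite !dotE !mxE; ring. Qed.

Lemma dotZr u v t : dot u (t *: v) = t * dot u v.
Proof. by rewrite !dotE !mxE; ring. Qed.

Lemma dotDl u v x : dot (u + v) x = dot u x + dot v x.
Proof. by rewrite !dotE !mxE; ring. Qed.

Lemma dotZl u v t : dot (t *: u) v = t * dot u v.
Proof. by rewrite !dotE !mxE; ring. Qed.

Lemma dotNl u v : dot (- u) v = - dot u v.
Proof. by rewrite !dotE !mxE; ring. Qed.

Lemma dotNr u v : dot u (- v) = - dot u v.
Proof. by rewrite !dotE !mxE; ring. Qed.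

Definition dotlin := (dotDr, dotBr, dotZr, dotDl, dotZl, dotNl, dotNr).

Definition rot u : 'rV[R]_2 := vec2 (- u 0 ord_max) (u 0 ord0).

Lemma dot_rotr u v : dot u (rot v) = - dot (rot u) v.
Proof. by rewrite !dotE /rot !vec2E; ring. Qed.

Lemma dot_rot u v : dot (rot u) (rot v) = dot u v.
Proof. by rewrite !dotE /rot !vec2E; ring. Qed.

Lemma dot_rotl u : dot (rot u) u = 0.
Proof. by rewrite !dotE /rot !vec2E; ring. Qed.

Lemma Z2P x : reflect (exists m n : int, x = vec2 m%:~R n%:~R)
  (x \is a mxOver Num.int).
Proof.
apply: (iffP mxOverP) => [xZ|[m [n ->]] i].
  have /intrP[m xm] := xZ 0 ord0; have /intrP[n xn] := xZ 0 ord_max.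
  by exists m, n; apply: rV2P; rewrite vec2E.
by move=> j; rewrite mxE; case: ifP => _; apply: intr_int.
Qed.

Lemma Z2_vec2 (m n : int) : @Z2 R (vec2 m%:~R n%:~R).
Proof. by apply/Z2P; exists m, n. Qed.

Lemma convex_setP (C : set 'rV[R]_2) :
  (forall x y (t : R), C x -> C y -> 0 <= t <= 1 ->
    C (t *: x + (1 - t) *: y)) <->
  convex_set C.
Proof.
split=> [h x y l|h x y t Cx Cy t01].
  rewrite !inE => Cx Cy; apply: (h x y l%:num Cx Cy).
  by apply/andP; split.
have [t0 t1] := andP t01.
by have := h x y (Itv01 t0 t1); rewrite !inE; apply.
Qed.

(** The choice 1 / (2 + S), with S the sum of all ratios |b i| / a i, serves every index at once. It
    supplies the sizes of the rotations. *)
Lemma exists_small (I : finType) (a b : I -> R) : (forall i, 0 < a i) ->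
  exists2 e, 0 < e <= 2^-1 & forall i, e * `|b i| <= a i.
Proof.
move=> a0; set S := \sum_i `|b i| / a i.
have S0 : 0 <= S by apply: sumr_ge0 => i _; rewrite divr_ge0// ltW.
exists (2 + S)^-1 => [|i].
  by rewrite invr_gt0 lef_pV2 ?posrE; lra.
rewrite mulrC ler_pdivrMr; last lra.
rewrite -ler_pdivrMl// mulrC.
have : `|b i| / a i <= S.
  rewrite /S (bigD1 i)//= lerDl.
  by apply: sumr_ge0 => j _; rewrite divr_ge0// ltW.
lra.
Qed.

Lemma interior_push (C : set 'rV[R]_2) x d :
  C° x -> exists2 e, 0 < e & C (x + e *: d).
Proof.
move=> Cx.
have cvg0 : (fun e : R => x + e *: d) @ 0^'+ --> x.
  rewrite -[X in _ --> X]addr0 -(scale0r d).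
  apply: cvgD; first exact: cvg_cst.
  by apply: cvgZr_tmp; apply: cvg_at_right_filter; apply: cvg_id.
have /= near0 := cvg0 _ Cx.
near (0 : R)^'+ => e.
exists e => //; near: e; exact: near0.
Unshelve. all: by end_near. Qed.

End Plane.

(** * Gauges of splits *)

Section Polyhedra.
Context {R : realType}.
Implicit Types (u v x y f r w d : 'rV[R]_2).

Lemma convex_polyM f n (B : 'M[R]_(n, 2)) : convex_set (polyM f B).
Proof.
apply/convex_setP => x y t xB yB /andP[t0 t1] i.
have := xB i; have := yB i; rewrite !dotlin => hy hx.
have : t * (dot (row i B) x - dot (row i B) f) <= t * 1 by apply: ler_wpM2l.
have : (1 - t) * (dot (row i B) y - dot (row i B) f) <= (1 - t) * 1.
  by apply: ler_wpM2l => //; lra.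
lra.
Qed.

(** Pushing [x] away from [f] multiplies every row value by 1 + e, so none of them can already be 1
    or more. *)
Lemma interior_polyM f n (B : 'M[R]_(n, 2)) x i :
  (polyM f B)° x -> dot (row i B) (x - f) < 1.
Proof.
move=> /(@interior_push _ _ _ (x - f))[e e0 /(_ i)].
rewrite (_ : x + _ - f = (1 + e) *: (x - f)); last first.
  by apply/rowP => j; rewrite !mxE; ring.
by rewrite dotZr; set t := dot _ _ => h; nra.
Qed.

Lemma polyM_push f n (B : 'M[R]_(n, 2)) d :
  exists2 e, 0 < e & polyM f B (f + e *: d).
Proof.
have [e /andP[e0 _] small] := @exists_small R 'I_n (fun=> 1)
  (fun i => dot (row i B) d) (fun=> ltr01).
exists e => // i; rewrite addrC addKr dotZr.
by apply: le_trans (small i); rewrite ler_pM2l// ler_norm.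
Qed.

Lemma psi_leP n (B : 'M[R]_(n.+1, 2)) r l :
  psi B r <= l <-> forall i, dot (row i B) r <= l.
Proof.
split=> [/bigmax_leP[_ h] i|h]; first exact: h.
by apply/bigmax_leP; split.
Qed.

(** At positive levels the gauge is read off from the set [polyM f B] alone. *)
Lemma psi_polyM f n (B : 'M[R]_(n.+1, 2)) r l : 0 < l ->
  psi B r <= l <-> polyM f B (f + l^-1 *: r).
Proof.
move=> l0; rewrite psi_leP; split=> h i; have := h i;
  by rewrite addrC addKr dotZr mulrC ler_pdivrMr// mul1r.
Qed.

End Polyhedra.

Section Splits.
Context {R : realType}.
Implicit Types (u v x y f r w d : 'rV[R]_2).

Definition normal (a b : int) : 'rV[R]_2 := vec2 a%:~R b%:~R.

Definition in_split f w (c : int) :=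
  (c%:~R < dot w f) && (dot w f < c%:~R + 1).

(* The gauge of the split [c <= w.x <= c + 1] with respect to [f]. *)
Definition psi_split f w (c : int) r : R :=
  Num.max (dot w r / (c%:~R + 1 - dot w f)) (- dot w r / (dot w f - c%:~R)).

(** Negating the normal swaps the two sides; this reduces later arguments to the side w.x = c +
    1. *)
Lemma in_splitN f w c : in_split f (- w) (- c - 1) = in_split f w c.
Proof.
by rewrite /in_split dotNl rmorphB rmorphN/=; apply/idP/idP => /andP[? ?];
  apply/andP; split; lra.
Qed.

Lemma psi_splitN f w c r : psi_split f (- w) (- c - 1) r = psi_split f w c r.
Proof.
rewrite /psi_split maxC !dotNl rmorphB rmorphN/=.
by congr (Num.max (_ / _) (_ / _)); lra.
Qed.

Lemma normal_neq0 a b : coprimez a b -> dot (normal a b) (normal a b) > 0.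
Proof.
move=> ab; rewrite dotE !vec2E -!expr2 lt_neqAle addr_ge0 ?sqr_ge0// andbT.
rewrite eq_sym paddr_eq0 ?sqr_ge0// !sqrf_eq0 !intr_eq0.
by apply/negP => /andP[/eqP a0 /eqP b0]; rewrite a0 b0 in ab.
Qed.

Lemma psi_split_leP f w c r l : in_split f w c -> 0 < l ->
  psi_split f w c r <= l <->
  c%:~R <= dot w (f + l^-1 *: r) <= c%:~R + 1.
Proof.
move=> /andP[cf fc] l0.
have l10 : 0 < l^-1 by rewrite invr_gt0.
have ll : l^-1 * l = 1 by rewrite mulVf// gt_eqF.
rewrite /psi_split ge_max ler_pdivrMr; last lra.
rewrite ler_pdivrMr; last lra.
rewrite !dotlin; set p := dot w r; set F := dot w f in cf fc *.
split=> /andP[h1 h2].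
- have : l^-1 * p <= l^-1 * (l * (c%:~R + 1 - F)) by rewrite ler_pM2l.
  have : l^-1 * (- p) <= l^-1 * (l * (F - c%:~R)) by rewrite ler_pM2l.
  by rewrite !mulrA ll !mul1r => ? ?; apply/andP; split; lra.
- apply/andP; split; rewrite -(ler_pM2l l10) mulrA ll mul1r; lra.
Qed.

Lemma psi_split_gt0 f w c r : in_split f w c -> dot w r != 0 ->
  0 < psi_split f w c r.
Proof.
move=> /andP[cf fc]; rewrite neq_lt /psi_split lt_max => /orP[p0|p0];
  apply/orP; [right|left]; rewrite divr_gt0//; lra.
Qed.

Lemma eq_of_pos_upper_bounds (s t : R) : 0 < t ->
  (forall l, 0 < l -> s <= l <-> t <= l) -> s = t.
Proof.
move=> t0 h; apply/eqP; rewrite eq_le (h t t0).2// andTb leNgt.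
(* If s < t, the level max(s, t / 2) is positive, at least s and below t. *)
apply/negP => st; have l0 : 0 < Num.max s (t / 2) by rewrite lt_max; lra.
have := (h _ l0).1; rewrite le_max lexx => /(_ isT); rewrite le_max; lra.
Qed.

(** The split contains the whole line through [f] along [r], and a row bounded above on a line is
    constant there. *)
Lemma split_matrices_rot f (B : 'M[R]_(3, 2)) w c i :
  polyM f B = [set x | c%:~R <= dot w x <= c%:~R + 1] ->
  in_split f w c -> forall r, dot w r = 0 -> dot (row i B) r = 0.
Proof.
move=> BE /andP[cf fc] r wr.
have inB t : polyM f B (f + t *: r).
  by rewrite BE /= !dotlin wr; apply/andP; split; lra.
apply/eqP; apply: contraT => p0.
have := inB (2 / dot (row i B) r) i.
rewrite addrC addKr dotZr mulfVK//; lra.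
Qed.

(** Where w.r is nonzero, the gauge is positive and hence determined by the set; on the remaining
    rays every row vanishes. *)
Lemma split_matricesP f (B : 'M[R]_(3, 2)) : split_matrices f B ->
  exists a b c : int, [/\ coprimez a b, in_split f (normal a b) c,
    polyM f B = [set x | c%:~R <= dot (normal a b) x <= c%:~R + 1] &
    forall r, psi B r = psi_split f (normal a b) c r].
Proof.
move=> [a [b [c [ab BE]]]]; exists a, b, c.
have {}BE : polyM f B = [set x | c%:~R <= dot (normal a b) x <= c%:~R + 1].
  by rewrite BE; apply/seteqP; split => x; rewrite /= dotE !vec2E.
set w := normal a b in BE *.
have w0 : 0 < dot w w by exact: normal_neq0.
(* A small step from [f] along w, and one along -w, stay in the split; this makes both inequalities
   strict. *)
have fs : in_split f w c.
  have [e e0] := polyM_push f B w; rewrite BE /= !dotlin => /andP[_ h1].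
  have [e' e'0] := polyM_push f B (- w); rewrite BE /= !dotlin => /andP[h2 _].
  have := mulr_gt0 e0 w0; have := mulr_gt0 e'0 w0.
  by rewrite /in_split => ? ?; apply/andP; split; lra.
split=> // r.
have [wr|wr] := eqVneq (dot w r) 0.
  rewrite /psi_split wr oppr0 !mul0r maxxx /psi.
  have row0 i := split_matrices_rot i BE fs wr.
  rewrite row0; under eq_bigr do rewrite row0.
  by rewrite bigmax_idl// big_const iter_fix ?maxxx.
apply: eq_of_pos_upper_bounds; first exact: psi_split_gt0.
by move=> l l0; rewrite (psi_polyM f)// BE psi_split_leP.
Qed.

End Splits.

(** * Rotating a side of a split *)

Section Decomposition.
Context {R : realType}.
Implicit Types (u v x y z f w d : 'rV[R]_2).

Definition rows3 u v w : 'M[R]_(3, 2) := \matrix_(i < 3) [:: u; v; w]`_i.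

Lemma row_rows3 u v w (P : 'rV[R]_2 -> Prop) :
  P u -> P v -> P w -> forall i, P (row i (rows3 u v w)).
Proof. by move=> Pu Pv Pw [[|[|[|//]]] i3]; rewrite rowK. Qed.

Lemma rows3_row u v w (P : 'rV[R]_2 -> Prop) :
  (forall i, P (row i (rows3 u v w))) -> [/\ P u, P v & P w].
Proof.
move=> h; have := h (inord 0); have := h (inord 1); have := h (inord 2).
by rewrite !rowK !inordK.
Qed.

Lemma psi_rows3 u v w x :
  psi (rows3 u v w) x = Num.max (dot u x) (Num.max (dot v x) (dot w x)).
Proof.
apply/eqP; rewrite eq_le; apply/andP; split.
  apply/psi_leP; set m := Num.max _ _.
  by apply: (@row_rows3 u v w (fun y => dot y x <= m));
    rewrite /m !le_max lexx ?orbT.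
have [] := @rows3_row u v w (fun y => dot y x <= psi (rows3 u v w) x).
  exact/psi_leP.
by rewrite !ge_max => -> -> ->.
Qed.

(** The Bézout coefficients of a and b recover t from x - z = t (-b, a). *)
Lemma lattice_line (a b : int) x z : coprimez a b -> Z2 x -> Z2 z ->
  dot (normal a b) x = dot (normal a b) z ->
  exists t : int, x = z + t%:~R *: rot (normal a b).
Proof.
move=> /coprimezP[[e1 e2] /= e] /Z2P[m [n ->]] /Z2P[m' [n' ->]].
rewrite !dotE !vec2E -!intrM -!intrD => /intr_inj h.
exists (e1 * (n - n') - e2 * (m - m')).
have h0 : a * m + b * n - (a * m' + b * n') = 0 by rewrite h subrr.
apply: rV2P; rewrite !mxE !eqxx /= -?intrN -!intrM -!intrD; congr (_%:~R).
  transitivity (m' + (m - m') * (e1 * a + e2 * b)); first by rewrite e; ring.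
  by apply/eqP; rewrite -subr_eq0 -(mulr0 e1) -h0; apply/eqP; ring.
transitivity (n' + (n - n') * (e1 * a + e2 * b)); first by rewrite e; ring.
by apply/eqP; rewrite -subr_eq0 -(mulr0 e2) -h0; apply/eqP; ring.
Qed.

Lemma lattice_level (a b c : int) : coprimez a b ->
  exists2 z : 'rV[R]_2, Z2 z & dot (normal a b) z = c%:~R.
Proof.
move=> /coprimezP[[e1 e2] /= e].
exists (vec2 (c * e1)%:~R (c * e2)%:~R); first exact: Z2_vec2.
rewrite dotE !vec2E -!intrM -!intrD; congr (_%:~R).
by transitivity (c * (e1 * a + e2 * b)); [ring|rewrite e mulr1].
Qed.

Lemma dot_normal_Z2 (a b : int) x : Z2 x ->
  exists h : int, dot (normal a b) x = h%:~R.
Proof.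
move=> /Z2P[m [n ->]]; exists (a * m + b * n).
by rewrite dotE !vec2E -!intrM -intrD.
Qed.

Section Perturbation.
Variables (a b c : int) (f z : 'rV[R]_2).
Let w : 'rV[R]_2 := normal a b.
Let al := dot w f - c%:~R.
Let be := c%:~R + 1 - dot w f.
Let d := rot (z - f).

(* The side [w.x = c + 1] is rotated about the lattice point [z] on it, and the
   third row is the same side rotated by a larger amount about the next lattice
   point [z - s *: rot w], so that it cuts off the lattice points uncovered by
   the first rotation. *)
Definition perturbation (kap del s : R) : 'M[R]_(3, 2) :=
  rows3 (be^-1 *: w + (s * del) *: d) (- al^-1 *: w)
        ((be^-1 - kap) *: w - (s * kap) *: d).

Hypotheses (ab : coprimez a b) (fs : in_split f w c).
Hypotheses (zZ : Z2 z) (zc : dot w z = c%:~R + 1).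

(** By the second row, an interior lattice point has level at least c + 1. On level c + 1 the other
    two rows leave it strictly between consecutive lattice points; on higher levels they contradict
    each other. *)
Lemma perturbation_lattice_free (kap del s : R) :
  0 < kap -> 0 < del <= 2^-1 -> s = 1 \/ s = -1 ->
  lattice_free (polyM f (perturbation kap del s)).
Proof.
move=> kap0 /andP[del0 del2] s1; split; first exact: convex_polyM.
apply/seteqP; split=> // x [xM xZ]; exfalso.
have [] := @rows3_row (be^-1 *: w + (s * del) *: d) (- al^-1 *: w)
  ((be^-1 - kap) *: w - (s * kap) *: d) (fun u => dot u (x - f) < 1).
  by move=> i; exact: interior_polyM xM.
have [al0 be0 albe] : [/\ 0 < al, 0 < be & al + be = 1].
  by rewrite /al /be; have /andP[? ?] := fs; split; lra.
rewrite !(dotDl, dotZl, dotNl); set p := dot w (x - f); set q := dot d (x - f).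
have [h wx] := dot_normal_Z2 a b xZ.
have pE : p = be + (h - c - 1)%:~R.
  by rewrite /p dotBr wx /be !rmorphB/= /w; lra.
move=> r1 r2 r3.
have {}r2 : - al < p by have : - al * 1 < - al * (- al^-1 * p);
  [rewrite ltr_nM2l// ; lra|rewrite mulrA mulrNN mulfV ?mul1r ?mulr1// gt_eqF].
have h0 : 0 <= h - c - 1.
  have : (-1)%:~R < (h - c - 1)%:~R :> R by rewrite rmorphN/=; lra.
  by rewrite ltr_int; lia.
have ib0 : 0 < be^-1 by rewrite invr_gt0.
have ibb : be^-1 * be = 1 by rewrite mulVf// gt_eqF.
(* On level c + 2 or more, [kap] times the first row plus [del] times the third cancels [d], and the
   sum contradicts p >= be + 1 because del <= 1/2 and be < 1. *)
have [h1|h1] := leP 1 (h - c - 1).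
  have {h1} : 1%:~R <= (h - c - 1)%:~R :> R by rewrite ler_int.
  move=> h1; have {}h1 : be + 1 <= p by lra.
  have ib1 : 1 <= be^-1 by rewrite invf_ge1//; lra.
  have {}r1 : kap * (be^-1 * p + s * del * q) < kap * 1 by rewrite ltr_pM2l.
  have {}r3 : del * ((be^-1 - kap) * p - s * kap * q) < del * 1.
    by rewrite ltr_pM2l.
  have h4 : kap * (be + 1) * del <= kap * be^-1.
    rewrite -mulrA ler_pM2l//; apply: le_trans ib1.
    have : (be + 1) * del <= (be + 1) * 2^-1 by apply: ler_wpM2l; lra.
    lra.
  have h5 : 0 <= (kap * be^-1 + del * be^-1 - kap * del) * (p - (be + 1)).
    have : 0 < kap * be * del by rewrite !mulr_gt0.
    have : 0 < del * be^-1 by rewrite mulr_gt0.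
    by move=> ? ?; apply: mulr_ge0; lra.
  have h7 : 0 < del * be^-1 by rewrite mulr_gt0.
  have h8 : del * be^-1 * be = del by rewrite -mulrA ibb mulr1.
  have h9 : kap * be^-1 * be = kap by rewrite -mulrA ibb mulr1.
  lra.
have {h0 h1} h0 : h - c - 1 = 0 by lia.
rewrite h0 addr0 in pE.
(* On level c + 1, [x] is t steps of [rot w] away from [z], and q measures t in units of be. *)
have [|t xt] := lattice_line ab xZ zZ.
  by rewrite zc; move: pE; rewrite /p dotBr /be; lra.
have qE : q = be * t%:~R.
  rewrite /q xt addrAC.
  rewrite dotDr dot_rotl add0r dotZr dot_rot mulrC; congr (_ * _).
  by rewrite /be -zc !dotE !mxE; ring.
rewrite pE ibb in r1; rewrite pE mulrBl ibb in r3.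
have {}r1 : s * t%:~R < 0.
  have : (del * be) * (s * t%:~R) < (del * be) * 0.
    by rewrite mulr0; move: r1; rewrite qE; lra.
  by rewrite ltr_pM2l// mulr_gt0.
have {}r3 : -1 < s * t%:~R.
  have : (kap * be) * (-1) < (kap * be) * (s * t%:~R).
    by move: r3; rewrite qE; lra.
  by rewrite ltr_pM2l// mulr_gt0.
have absurd (u : int) : -1 < u%:~R :> R -> u%:~R < 0 :> R -> False.
  have -> : -1 = (-1)%:~R :> R by rewrite rmorphN.
  by rewrite ltr_int ltrz0; lia.
case: s1 r1 r3 => ->; rewrite ?mul1r ?mulN1r; first by move=> ? /absurd; exact.
by rewrite -[- t%:~R]rmorphN => ? /absurd; exact.
Qed.

(** For p > 0 the rotated side gives the largest row, for p < 0 the opposite side does. So the gauge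
    changes only on rays hitting the rotated side, by an amount odd in [s]. *)
Lemma psi_perturbation (kap del s : R) r : s = 1 \/ s = -1 ->
  let p := dot w r in let q := dot d r in
  0 <= kap -> 0 <= del ->
  kap * (`|p| + `|q|) <= `|p| * (al^-1 + be^-1) ->
  del * `|q| <= `|p| * (al^-1 + be^-1) ->
  (0 < p -> del * `|q| <= kap * (p - `|q|)) ->
  p != 0 ->
  psi (perturbation kap del s) r =
    psi_split f w c r + s * del * (if 0 < p then q else 0).
Proof.
move=> s1 p q kap0 del0 hk hd hpos p0.
have [al0 be0] : 0 < al /\ 0 < be.
  by rewrite /al /be; have /andP[? ?] := fs; split; lra.
rewrite psi_rows3 !(dotDl, dotZl, dotNl) -/p -/q /psi_split -/al -/be -/p.
have [ia0 ib0] : 0 < al^-1 /\ 0 < be^-1 by rewrite !invr_gt0.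
have [q1 q2] : del * q <= del * `|q| /\ - (del * `|q|) <= del * q.
  by split; rewrite -?mulrN ler_wpM2l// ?ler_norm// lerNl -normrN ler_norm.
have [q3 q4] : kap * q <= kap * `|q| /\ - (kap * `|q|) <= kap * q.
  by split; rewrite -?mulrN ler_wpM2l// ?ler_norm// lerNl -normrN ler_norm.
have [pp|pn] := ltP 0 p.
  have {}hpos := hpos pp; rewrite (gtr0_norm pp) in hk hd.
  have ? : 0 < p * al^-1 by rewrite mulr_gt0.
  have ? : 0 < p * be^-1 by rewrite mulr_gt0.
  rewrite [X in _ = X + _]max_l; last lra.
  rewrite max_l ?ge_max; first by rewrite [be^-1 * p]mulrC.
  by apply/andP; split; case: s1 => ->; lra.
have {p0}pn : p < 0 by rewrite lt_neqAle p0.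
rewrite (ltr0_norm pn) in hk hd.
have ? : 0 < (- p) * al^-1 by rewrite mulr_gt0// oppr_gt0.
have ? : 0 < (- p) * be^-1 by rewrite mulr_gt0// oppr_gt0.
rewrite [X in _ = X + _]max_r; last lra.
rewrite [X in Num.max _ X]max_l; last by case: s1 => ->; lra.
rewrite max_r; last by case: s1 => ->; lra.
by lra.
Qed.

End Perturbation.

Lemma split_decomposition k (r : 'I_k -> 'rV[R]_2) (a b c : int) f z :
  let w := normal a b in let q j := dot (rot (z - f)) (r j) in
  coprimez a b -> in_split f w c -> Z2 z -> dot w z = c%:~R + 1 ->
  (forall j, dot w (r j) != 0) ->
  (forall j, 0 < dot w (r j) -> `|q j| < dot w (r j)) ->
  (exists2 j, 0 < dot w (r j) & q j != 0) ->
  exists g1 g2, [/\ Delta f r g1, Delta f r g2 &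
    strict_convex_combination (\row_j psi_split f w c (r j)) g1 g2].
Proof.
move=> w q ab fs zZ zc p0 qp [j0 pj0 qj0].
have [al0 be0] : 0 < dot w f - c%:~R /\ 0 < c%:~R + 1 - dot w f.
  by have /andP[? ?] := fs; split; lra.
set S := (dot w f - c%:~R)^-1 + (c%:~R + 1 - dot w f)^-1.
have S0 : 0 < S by rewrite /S addr_gt0 ?invr_gt0.
have A0 j : 0 < `|dot w (r j)| * S by rewrite mulr_gt0 ?normr_gt0.
have [kap /andP[kap0 _] hkap] := @exists_small R 'I_k _
  (fun j => `|dot w (r j)| + `|q j|) A0.
(* [kap] is fixed first; [m] then bounds [del] so that on rays hitting the side the third row does
   not exceed the first. *)
pose m j := Num.min (`|dot w (r j)| * S)
  (if 0 < dot w (r j) then kap * (dot w (r j) - `|q j|) else 1).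
have m0 j : 0 < m j.
  by rewrite lt_min A0 /=; case: ifP => // pj; rewrite mulr_gt0// subr_gt0 qp.
have [del del0 hdel] := exists_small q m0.
have delp : 0 < del by case/andP: del0.
have psiE s j : s = 1 \/ s = -1 ->
    psi (perturbation a b c f z kap del s) (r j) =
    psi_split f w c (r j) + s * del * (if 0 < dot w (r j) then q j else 0).
  move=> s1; apply: psi_perturbation => //; first exact: ltW.
  - exact: ltW.
  - by apply: le_trans (hkap j); rewrite [X in _ <= _ * X]ger0_norm// addr_ge0.
  - by apply: (le_trans (hdel j)); rewrite ge_min lexx.
  - by move=> pj; apply: (le_trans (hdel j)); rewrite /m pj ge_min lexx orbT.
have one1 : 1 = 1 :> R \/ 1 = -1 :> R by left.
have onem : -1 = 1 :> R \/ -1 = -1 :> R by right.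
exists (gamma r (perturbation a b c f z kap del 1)),
  (gamma r (perturbation a b c f z kap del (-1))); split.
- by eexists; [|reflexivity]; apply: perturbation_lattice_free.
- by eexists; [|reflexivity]; apply: perturbation_lattice_free.
split.
  move=> /rowP/(_ j0); rewrite !mxE !psiE// pj0 => /eqP.
  have : del * q j0 != 0 by rewrite mulf_neq0// gt_eqF.
  by move=> /eqP h /eqP; lra.
apply/rowP => j; rewrite !mxE !psiE//.
by field.
Qed.

End Decomposition.

(** * Splits outside the exceptional cases *)

Lemma card_ge2 (T : Type) (A : set T) x y : A x -> A y -> x <> y -> `I_2 #<= A.
Proof.
move=> Ax Ay xy; pose h (n : nat) := if n == 0%N then x else y.
have hinj : set_inj `I_2 h.
  by move=> [|[|m]] [|[|n]]; rewrite ?in_setE /h //= => _ _ e; case: xy.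
have /card_eqPle[_ hle] := inj_card_eq hinj.
apply: card_le_trans hle _; apply: subset_card_le.
by move=> _ [n _ <-]; rewrite /h; case: ifP.
Qed.

Section NonExceptional.
Context {R : realType}.
Implicit Types (u v x y z f w d : 'rV[R]_2).

(** Row [ord0] is the side w.x = c + 1, so that [case_c] tests a chosen side. *)
Definition canonical_matrix f w (c : int) : 'M[R]_(3, 2) :=
  rows3 ((c%:~R + 1 - dot w f)^-1 *: w) (- (dot w f - c%:~R)^-1 *: w)
        (- (dot w f - c%:~R)^-1 *: w).

Lemma polyM_canonical f w c : in_split f w c ->
  polyM f (canonical_matrix f w c) =
  [set x | c%:~R <= dot w x <= c%:~R + 1].
Proof.
move=> /andP[cf fc]; apply/seteqP; split=> x /=.
  move=> /(@rows3_row R _ _ _ (fun u => dot u (x - f) <= 1))[].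
  rewrite /= !dotZl !mulNr -!mulrN !ler_pdivrMl ?subr_gt0// dotBr.
  by move=> ? ? _; apply/andP; split; lra.
move=> /andP[cx xc]; apply: (@row_rows3 R _ _ _ (fun u => dot u (x - f) <= 1));
  by rewrite /= dotZl ?mulNr -?mulrN ler_pdivrMl ?subr_gt0// dotBr; lra.
Qed.

Lemma psi_canonical f w c r :
  psi (canonical_matrix f w c) r = psi_split f w c r.
Proof.
rewrite psi_rows3 maxxx !dotZl /psi_split mulrC; congr (Num.max _ _).
by rewrite mulNr mulrC mulNr.
Qed.

Lemma split_matrices_canonical f a b c : coprimez a b ->
  in_split f (normal a b) c ->
  split_matrices f (canonical_matrix f (normal a b) c).
Proof.
move=> ab fs; exists a, b, c; split=> //.
by rewrite polyM_canonical//; apply/seteqP; split=> x /=; rewrite dotE !vec2E.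
Qed.

Lemma case_b_canonical f w c k (r : 'I_k -> 'rV[R]_2) j : in_split f w c ->
  dot w (r j) = 0 -> case_b f r (canonical_matrix f w c).
Proof.
move=> fs wr; exists j => x t; rewrite polyM_canonical//= => xs _.
by rewrite dotDr dotZr wr mulr0 addr0.
Qed.

Lemma conv_hull_segment (S : set 'rV[R]_2) z u (s t n : R) : s < t ->
  s <= n <= t -> S (z + s *: u) -> S (z + t *: u) -> conv_hull S (z + n *: u).
Proof.
move=> st /andP[sn nt] Ss St A /= [/convex_setP Ac SA].
have ts0 : t - s != 0 by rewrite gt_eqF// subr_gt0.
pose l := (t - n) / (t - s).
have -> : z + n *: u = l *: (z + s *: u) + (1 - l) *: (z + t *: u).
  by apply/rowP => j; rewrite !mxE /l; field.
apply: Ac; [exact: SA|exact: SA|].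
rewrite /l divr_ge0 ?ler_pdivrMr ?mul1r; try lra.
Qed.

Lemma orthogonal_rot w v : dot w v = 0 -> dot w w != 0 ->
  v = (dot (rot w) v / dot w w) *: rot w.
Proof.
move=> wv0 ww.
have e : dot w w *: v = dot (rot w) v *: rot w + dot w v *: w.
  by apply: rV2P; rewrite !(mxE, dotE) /=; ring.
apply: (scalerI ww); rewrite e wv0 scale0r addr0 scalerA; congr (_ *: _).
by field.
Qed.

Lemma Z2_translate z (m a b : int) : Z2 z -> Z2 (z + m%:~R *: rot (normal a b)).
Proof.
move=> /Z2P[z1 [z2 ->]]; apply/Z2P; exists (z1 - m * b), (z2 + m * a).
by apply: rV2P; rewrite !mxE /= ?rmorphB ?rmorphD !rmorphM/=; ring.
Qed.

(* The inequality in the conclusion says that the hit point of [r j] lies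
   strictly between the lattice points [z - rot w] and [z + rot w]. *)
Lemma exists_pivot k (r : 'I_k -> 'rV[R]_2) (a b c : int) f j0 :
  let w := normal a b in
  coprimez a b -> in_split f w c ->
  ~ case_c f r (canonical_matrix f w c) ->
  0 < dot w (r j0) -> ~ Z2 (f + (psi_split f w c (r j0))^-1 *: r j0) ->
  exists z, [/\ Z2 z, dot w z = c%:~R + 1,
    forall j, 0 < dot w (r j) -> `|dot (rot (z - f)) (r j)| < dot w (r j) &
    exists2 j, 0 < dot w (r j) & dot (rot (z - f)) (r j) != 0].
Proof.
move=> w ab fs nc pj0 nZ.
have [z0 z0Z z0c] := @lattice_level R a b (c + 1) ab.
rewrite -/w rmorphD/= in z0c.
have [al0 be0] : 0 < dot w f - c%:~R /\ 0 < c%:~R + 1 - dot w f.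
  by have /andP[? ?] := fs; split; lra.
have ww : dot w w != 0 by rewrite gt_eqF// normal_neq0.
set be := c%:~R + 1 - dot w f in be0.
pose p j := dot w (r j).
pose pt j := f + (be / p j) *: r j.
have psiE j : 0 < p j -> psi_split f w c (r j) = p j / be.
  move=> pj; rewrite /psi_split max_l//.
  apply: (@le_trans _ _ 0); last by rewrite divr_ge0// ltW.
  by rewrite mulNr oppr_le0 divr_ge0// ltW.
(* The position of the hit point on the side, measured from [z0] in units of [rot w]. *)
pose t j := dot (rot w) (pt j - z0) / dot w w.
have ptE j : 0 < p j -> pt j = z0 + t j *: rot w.
  move=> pj; rewrite addrC /t -orthogonal_rot ?subrK//.
  rewrite dotBr z0c dotDr dotZr -/(p j) mulfVK ?gt_eqF// /be; lra.
have qE (m : R) j : 0 < p j ->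
    dot (rot (z0 + m *: rot w - f)) (r j) = p j * (t j - m).
  move=> pj; set z := z0 + _.
  have -> : r j = (p j / be) *: ((z - f) + (t j - m) *: rot w).
    rewrite (_ : z - f + _ = pt j - f).
      by rewrite addrC addKr scalerA mulrA mulfVK ?mulfV ?scale1r// gt_eqF.
    by rewrite ptE// /z; apply/rowP => i; rewrite !mxE; ring.
  rewrite dotZr dotDr dot_rotl add0r dotZr dot_rot.
  have -> : dot (z - f) w = be.
    transitivity (dot w (z - f)); first by rewrite !dotE; ring.
    rewrite dotBr /z dotDr dotZr z0c dot_rotr dot_rotl /be; lra.
  by field; rewrite gt_eqF.
(* Two hits enclosing two consecutive lattice points put both into the hull, which is case c. *)
have gap i j (n : int) : 0 < p i -> 0 < p j -> t i <= n%:~R ->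
    n%:~R + 1 <= t j -> False.
  move=> pi pj ti tj; apply: nc.
  have ptF l : 0 < p l -> (ray_points f r (canonical_matrix f w c) `&`
      polyF f (canonical_matrix f w c) ord0) (z0 + t l *: rot w).
    move=> pl; rewrite -ptE//; split.
      by exists l; rewrite /= psi_canonical psiE ?divr_gt0// invf_div.
    have wpt : dot w (pt l) = c%:~R + 1.
      by rewrite dotDr dotZr -/(p l) mulfVK ?gt_eqF// /be; lra.
    split; first by rewrite polyM_canonical//= wpt; lra.
    rewrite /= rowK /= dotZl dotBr wpt mulVf// gt_eqF//.
  apply: (@card_ge2 _ _ (z0 + n%:~R *: rot w) (z0 + (n + 1)%:~R *: rot w)).
  - split; last exact: Z2_translate.
    by apply: (@conv_hull_segment _ _ _ (t i) (t j));
      [| |exact: ptF|exact: ptF]; lra.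
  - split; last exact: Z2_translate.
    apply: (@conv_hull_segment _ _ _ (t i) (t j)); [| |exact: ptF|exact: ptF];
      rewrite ?rmorphD/=; lra.
  - move=> /addrI/eqP; rewrite -subr_eq0 -scalerBl scaler_eq0 subr_eq0 eqr_int.
    rewrite orbC; case: eqP => [w0|_ /=]; last by move=> /eqP; lia.
    have := @normal_neq0 R a b ab.
    by rewrite -/w -dot_rot w0 dotE !mxE !mul0r addr0 ltxx.
have tZ (m : int) : t j0 != m%:~R.
  apply/eqP => tm; apply: nZ; rewrite psiE// invf_div -/(pt j0) ptE// tm.
  exact: Z2_translate.
have pivot (m : int) : (forall j, 0 < p j -> m%:~R - 1 < t j < m%:~R + 1) ->
  exists z, [/\ Z2 z, dot w z = c%:~R + 1,
    forall j, 0 < dot w (r j) -> `|dot (rot (z - f)) (r j)| < dot w (r j) &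
    exists2 j, 0 < dot w (r j) & dot (rot (z - f)) (r j) != 0].
  move=> tm; exists (z0 + m%:~R *: rot w); split.
  - exact: Z2_translate.
  - by rewrite dotDr dotZr z0c dot_rotr dot_rotl oppr0 mulr0 addr0.
  - move=> j pj; have /andP[? ?] := tm j pj.
    rewrite qE// normrM gtr0_norm// -/(p j) gtr_pMr// ltr_norml.
    by apply/andP; split; lra.
  - by exists j0 => //; rewrite qE// mulf_neq0 ?subr_eq0 ?tZ// gt_eqF.
(* The non-lattice hit lies strictly between m0 and m0 + 1. If some hit is at or before m0, then
   none reaches m0 + 1 and m0 is the pivot; otherwise m0 + 1 is. *)
have /andP[m0t tm0] := floor_itv (t j0); set m0 := Num.floor (t j0) in m0t tm0.
have {}m0t : m0%:~R < t j0 by rewrite lt_neqAle m0t andbT eq_sym tZ.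
rewrite intrD in tm0.
have [[i pi ti]|none] := pselect (exists2 i, 0 < p i & t i <= m0%:~R).
  apply: (pivot m0) => j pj; apply/andP; split; rewrite ltNge; apply/negP => tj.
    by apply: (gap j j0 (m0 - 1)) => //; rewrite rmorphB/=; lra.
  exact: (gap i j m0).
apply: (pivot (m0 + 1)) => j pj; apply/andP; split; rewrite ltNge;
  apply/negP => tj.
  by apply: none; exists j => //; rewrite rmorphD/= in tj; lra.
by apply: (gap j0 j (m0 + 1)) => //; rewrite rmorphD/=; lra.
Qed.

Lemma normalN (a b : int) : normal (- a) (- b) = - normal a b :> 'rV[R]_2.
Proof. by apply: rV2P; rewrite !mxE/= rmorphN. Qed.

(** Any exceptional matrix with this gauge vector would put it in [Xi0], so the cases fail for the
    canonical matrices of both orientations. The orientation is chosen to have a non-lattice hit on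
    w.x = c + 1. *)
Lemma Pi_decomposition k (r : 'I_k -> 'rV[R]_2) f g :
  (Pi f r `\` Xi0 f r) g -> exists g1 g2, [/\ Delta f r g1, Delta f r g2 &
    strict_convex_combination g g1 g2].
Proof.
move=> [[B /split_matricesP[a [b [c [ab fs BE psiE]]]] <-] nXi].
have gE (w : 'rV[R]_2) (e : int) :
    (forall x, psi_split f w e x = psi_split f (normal a b) c x) ->
    gamma r (canonical_matrix f w e) = gamma r B.
  by move=> h; apply/rowP => j; rewrite !mxE psi_canonical h psiE.
have nab : coprimez (- a) (- b) by rewrite coprimezN coprimeNz.
have nfs : in_split f (normal (- a) (- b)) (- c - 1).
  by rewrite normalN in_splitN.
have nexc (a' b' c' : int) : coprimez a' b' -> in_split f (normal a' b') c' ->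
    (forall x,
      psi_split f (normal a' b') c' x = psi_split f (normal a b) c x) ->
    let C := canonical_matrix f (normal a' b') c' in
    ~ [\/ case_a f r C, case_b f r C | case_c f r C].
  move=> ab' fs' h C exc; apply: nXi; exists C; last exact: gE.
  by split=> //; exact: split_matrices_canonical.
have p0 j : dot (normal a b) (r j) != 0.
  apply/eqP => wr; apply: (nexc a b c) => //; apply: Or32.
  exact: case_b_canonical wr.
have [j nZ] : exists j, ~ Z2 (f + (psi_split f (normal a b) c (r j))^-1 *: r j).
  apply/existsNP => h; apply: (nexc a b c) => //; apply: Or31.
  by move=> _ [j _ <-]; rewrite psi_canonical; exact: h.
have -> : gamma r B = \row_j psi_split f (normal a b) c (r j).
  by apply/rowP => i; rewrite !mxE psiE.
have := p0 j; rewrite neq_lt => /orP[pj|pj].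
  have nc : ~ case_c f r
      (canonical_matrix f (normal (- a) (- b)) (- c - 1)).
    move=> hc; apply: (nexc (- a) (- b) (- c - 1)) => //; last exact: Or33.
    by move=> x; rewrite normalN psi_splitN.
  have npj : 0 < dot (normal (- a) (- b)) (r j).
    by rewrite normalN dotNl oppr_gt0.
  rewrite -psi_splitN -normalN in nZ.
  have [z [zZ zc hq ex]] := exists_pivot nab nfs nc npj nZ.
  have -> : \row_j0 psi_split f (normal a b) c (r j0) =
      \row_j0 psi_split f (normal (- a) (- b)) (- c - 1) (r j0).
    by apply/rowP => i; rewrite !mxE normalN psi_splitN.
  apply: split_decomposition zZ zc _ hq ex => // i.
  by rewrite normalN dotNl oppr_eq0.
have nc : ~ case_c f r (canonical_matrix f (normal a b) c).
  by move=> hc; apply: (nexc a b c) => //; apply: Or33.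
have [z [zZ zc hq ex]] := exists_pivot ab fs nc pj nZ.
exact: split_decomposition zZ zc p0 hq ex.
Qed.

End NonExceptional.

(** * Edges of the integer hull of a cone *)

(** Bézout coefficients give the ratio of the two vectors as an integer, and primitivity makes it a
    unit. *)
Lemma coprimez_collinear (a b a' b' : int) : coprimez a b -> coprimez a' b' ->
  a * b' = b * a' -> (a' = a /\ b' = b) \/ (a' = - a /\ b' = - b).
Proof.
move=> /coprimezP[[e1 e2] /= e] /coprimezP[[e1' e2'] /= e'] h.
pose k := e1 * a' + e2 * b'.
have a'E : a' = k * a.
  transitivity (a' * (e1 * a + e2 * b)); first by rewrite e mulr1.
  transitivity (e1 * a' * a + e2 * (b * a')); first by ring.
  by rewrite -h /k; ring.
have b'E : b' = k * b.
  transitivity (b' * (e1 * a + e2 * b)); first by rewrite e mulr1.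
  transitivity (e2 * b' * b + e1 * (a * b')); first by ring.
  by rewrite h /k; ring.
have kU : k * (e1' * a + e2' * b) = 1.
  by rewrite -e' [in RHS]a'E [in RHS]b'E; ring.
have := congr1 absz kU; rewrite abszM => /eqP.
rewrite muln_eq1 => /andP[/eqP k1 _].
have [k1'|k1'] : k = 1 \/ k = -1 by lia.
  by left; rewrite a'E b'E k1' !mul1r.
by right; rewrite a'E b'E k1' !mulN1r.
Qed.

Section Counting.
Context {R : realType}.
Implicit Types (u v x y z f w d s t r : 'rV[R]_2).

Lemma in_split_inj f w c c' : in_split f w c -> in_split f w c' -> c = c'.
Proof.
move=> /andP[h1 h2] /andP[h3 h4].
have : c%:~R < (c' + 1)%:~R :> R by rewrite rmorphD/=; lra.
have : c'%:~R < (c + 1)%:~R :> R by rewrite rmorphD/=; lra.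
by rewrite !ltr_int; lia.
Qed.

Lemma psi_split_collinear f (a b c a' b' c' : int) r :
  coprimez a b -> coprimez a' b' ->
  in_split f (normal a b) c -> in_split f (normal a' b') c' ->
  dot (normal a b) (rot (normal a' b')) = 0 :> R ->
  psi_split f (normal a b) c r = psi_split f (normal a' b') c' r.
Proof.
move=> ab ab' fs fs'; rewrite dotE !vec2E => h.
have /(coprimez_collinear ab ab') : a * b' = b * a'.
  by apply: (@intr_inj R); rewrite !rmorphM/=; lra.
case=> -[ea eb]; rewrite ea eb in fs' *.
  by rewrite (in_split_inj fs fs').
have fs2 : in_split f (normal a b) (- c' - 1).
  by rewrite -in_splitN -normalN (_ : - (- c' - 1) - 1 = c')//; ring.
rewrite (in_split_inj fs fs2) -psi_splitN -normalN.
by congr (psi_split _ _ _ _); ring.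
Qed.

(* The side [w.x = c + 1] carries two consecutive lattice points [x] and
   [x + rot w] of the cone with apex [f] spanned by [s] and [t]. *)
Definition edge f s t w (c : int) x :=
  [/\ in_split f w c, 0 < dot w s, 0 < dot w t, Z2 x /\ dot w x = c%:~R + 1 &
      0 <= dot (rot s) (x - f) /\ 0 <= dot (rot (x + rot w - f)) t].

(** [dot (rot u) v] is the determinant of u and v; the right side holds the coordinates of [v] in
    the basis [s], [t], scaled by its determinant. *)
Lemma cramer s t v w :
  dot (rot s) t * dot w v = dot (rot v) t * dot w s + dot (rot s) v * dot w t.
Proof. by rewrite !dotE /rot !vec2E; ring. Qed.

(** The step from [x] to [x + rot w] lowers this coordinate by w.t, which is positive. *)
Lemma edge_ge0 f s t w c x : edge f s t w c x -> 0 <= dot (rot (x - f)) t.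
Proof.
move=> [_ _ wt _ [_ h]]; apply: le_trans h _.
rewrite -subr_ge0 (_ : _ - _ = dot w t) ?(ltW wt)//.
by rewrite !dotE /rot !(mxE, vec2E) /=; ring.
Qed.

(** In Cramer's rule for [x - f], the coordinate along [s] is at least w.t, hence positive. *)
Lemma edge_det_gt0 f s t w c x : edge f s t w c x -> 0 < dot (rot s) t.
Proof.
move=> ed; have N2 := edge_ge0 ed.
case: ed => [/andP[cf fc] ws wt [xZ wx] [N1 h]].
have be0 : 0 < dot w (x - f) by rewrite dotBr wx subr_gt0.
rewrite -(pmulr_lgt0 _ be0) cramer.
apply: ltr_wpDr; first by rewrite mulr_ge0// ltW.
rewrite mulr_gt0//; apply: lt_le_trans wt _.
rewrite -subr_ge0; apply: le_trans h _.
rewrite le_eqVlt; apply/orP; left; apply/eqP.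
by rewrite !dotE /rot !(mxE, vec2E) /=; ring.
Qed.

(** On the cone the level is at least w.f > c, and lattice points have integer levels. *)
Lemma cone_level f s t (a b c : int) x y :
  edge f s t (normal a b) c x -> Z2 y ->
  0 <= dot (rot s) (y - f) -> 0 <= dot (rot (y - f)) t ->
  c%:~R + 1 <= dot (normal a b) y.
Proof.
move=> ed yZ N1 N2; have D0 := edge_det_gt0 ed.
case: ed => [/andP[cf fc] ws wt _ _].
have : 0 <= dot (normal a b) (y - f).
  rewrite -(pmulr_rge0 _ D0) cramer.
  by rewrite addr_ge0// mulr_ge0// ltW.
have [h wy] := dot_normal_Z2 a b yZ; rewrite dotBr wy => hf.
have : c%:~R < h%:~R :> R by lra.
by rewrite ltr_int -intrD1 ler_int; lia.
Qed.

Lemma Z2D x y : Z2 x -> Z2 y -> Z2 (x + y).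
Proof.
move=> /Z2P[m [n ->]] /Z2P[m' [n' ->]]; apply/Z2P; exists (m + m'), (n + n').
by apply: rV2P; rewrite !mxE/= rmorphD.
Qed.

Lemma Z2B x y : Z2 x -> Z2 y -> Z2 (x - y).
Proof.
move=> /Z2P[m [n ->]] /Z2P[m' [n' ->]]; apply/Z2P; exists (m - m'), (n - n').
by apply: rV2P; rewrite !mxE/= rmorphB.
Qed.

Lemma Z2_rot_normal (a b : int) : Z2 (rot (normal a b) : 'rV[R]_2).
Proof.
by apply/Z2P; exists (- b), a; apply: rV2P; rewrite /rot !vec2E ?rmorphN.
Qed.

(* The reflection of [x'] in [x] stays in the cone, so neither point is beyond
   the other's edge, and both are on both edges. *)
Lemma edge_uniq f s t (a b c a' b' c' : int) x x' :
  edge f s t (normal a b) c x -> edge f s t (normal a' b') c' x' ->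
  dot (rot s) (x' - f) <= 2 * dot (rot s) (x - f) ->
  dot (rot s) (x - f) <= 2 * dot (rot s) (x' - f) ->
  dot (rot (x' - f)) t <= 2 * dot (rot (x - f)) t ->
  dot (rot (x - f)) t <= 2 * dot (rot (x' - f)) t ->
  dot (normal a b) (rot (normal a' b')) = 0 :> R.
Proof.
move=> ed ed' h1 h2 h3 h4.
have N2 := edge_ge0 ed; have N2' := edge_ge0 ed'.
have [_ ws wt [xZ wx] [N1 N3]] := ed.
have [_ ws' wt' [xZ' wx'] [N1' N3']] := ed'.
set w := normal a b in ed wx ws wt N3 *.
set w' := normal a' b' in ed' wx' ws' wt' N3' *.
have refl (y z : 'rV[R]_2) : y + y - z - f = 2 *: (y - f) - (z - f).
  by apply/rowP => i; rewrite !mxE; ring.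
have rotE (y z : 'rV[R]_2) : rot (2 *: y - z) = 2 *: rot y - rot z.
  by apply: rV2P; rewrite /rot !(mxE, vec2E) /=; ring.
have e1 : c%:~R + 1 <= dot w (x + x - x').
  apply: (cone_level ed); first by apply: Z2B => //; apply: Z2D.
    by rewrite refl dotBr dotZr subr_ge0.
  by rewrite refl rotE dotDl dotNl dotZl subr_ge0.
have e2 : c'%:~R + 1 <= dot w' (x' + x' - x).
  apply: (cone_level ed'); first by apply: Z2B => //; apply: Z2D.
    by rewrite refl dotBr dotZr subr_ge0.
  by rewrite refl rotE dotDl dotNl dotZl subr_ge0.
have e3 : c%:~R + 1 <= dot w x' by apply: (cone_level ed).
have e4 : c'%:~R + 1 <= dot w' x by apply: (cone_level ed').
rewrite !dotlin in e1 e2.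
have step (v y : 'rV[R]_2) : 0 <= dot (rot s) (y - f) -> 0 <= dot v s ->
    0 <= dot (rot s) (y + rot v - f).
  move=> hy hv; rewrite addrAC dotDr addr_ge0// dot_rot.
  by apply: le_trans hv _; rewrite !dotE; lra.
(* The second lattice points of the edges are in the cone too. As x and x' lie on both edges, w.rot
   w' and w'.rot w are nonnegative; they are also opposite. *)
have e5 : c%:~R + 1 <= dot w (x' + rot w').
  apply: (cone_level ed) => //; first by apply: Z2D => //; apply: Z2_rot_normal.
  by apply: step => //; exact: ltW.
have e6 : c'%:~R + 1 <= dot w' (x + rot w).
  apply: (cone_level ed') => //.
    by apply: Z2D => //; apply: Z2_rot_normal.
  by apply: step => //; exact: ltW.
rewrite dotDr in e5; rewrite dotDr in e6.
have e7 : dot w' (rot w) = - dot w (rot w').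
  by rewrite !dotE /rot !vec2E; ring.
lra.
Qed.

(* The shift by one leaves [0] alone in its class. *)
Definition dyadic_class (N : R) : nat := trunc_log 2 (Num.truncn N).+1.

(** Equal classes give n + 1 < 2 (n' + 1), and integrality absorbs the shift. *)
Lemma dyadic_class_le (N N' : R) : N \is a Num.int -> N' \is a Num.int ->
  0 <= N -> 0 <= N' -> dyadic_class N = dyadic_class N' -> N <= 2 * N'.
Proof.
move=> NZ NZ' N0 N0'; rewrite /dyadic_class.
have /natrP[n ->] : N \is a Num.nat by rewrite natrEint NZ.
have /natrP[n' ->] : N' \is a Num.nat by rewrite natrEint NZ'.
rewrite !natrK => e.
have /andP[_ h1] := @trunc_log_bounds 2 n.+1 isT isT.
have /andP[h2 _] := @trunc_log_bounds 2 n'.+1 isT isT.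
rewrite -natrM ler_nat.
by rewrite e expnS in h1; lia.
Qed.

Lemma dyadic_class_lt (N : R) L : N <= 2 ^+ L -> (dyadic_class N < L.+2)%N.
Proof.
move=> h; rewrite ltnS /dyadic_class -(@trunc_expnK 2 L.+1)//.
apply: leq_trunc_log.
have : (Num.truncn N <= 2 ^ L)%N.
  by rewrite truncn_le_nat (le_lt_trans h)// -natrX ltr_nat.
by have := expn_gt0 2 L; rewrite expnS; lia.
Qed.

End Counting.

(** * Counting the exceptional splits *)

(** An element may carry several tags; choosing for each tag an element that carries it covers
    [A]. *)
Lemma card_le_tags (T : finType) (U : choiceType) (A : set U)
    (P : U -> T -> Prop) :
  (forall u, A u -> exists t, P u t) ->
  (forall u v t, P u t -> P v t -> u = v) -> A #<= `I_#|T|.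
Proof.
move=> tag tag_inj.
have [->|/set0P[u0 _]] := eqVneq A set0; first exact: card_ge0.
pose h t := xget u0 [set u | P u t].
have Ah : A `<=` h @` [set: T].
  move=> u /tag[t Pt]; exists t => //; rewrite /h.
  by case: xgetP => [v _ Pv|/(_ u)//]; exact: tag_inj Pv Pt.
apply: card_le_trans (subset_card_le Ah) _.
apply: card_le_trans (card_image_le _ _) _.
have : set_inj [set: T] (fun t => enum_rank t : nat).
  by move=> s t _ _ /ord_inj/enum_rank_inj.
move=> /inj_card_eq/card_eqPle[_ hle]; apply: card_le_trans hle _.
by apply: subset_card_le => _ [t _ <-] /=.
Qed.

Section Exceptional.
Context {R : realType}.
Implicit Types (u v x y z f w d s t l : 'rV[R]_2).

(** This allows the rays to be replaced by lattice vectors. *)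
Lemma edge_scale f s t w c x (p q : R) : 0 < p -> 0 < q ->
  edge f s t w c x -> edge f (p *: s) (q *: t) w c x.
Proof.
move=> p0 q0 [fs ws wt xc [h1 h2]]; split=> //.
- by rewrite dotZr mulr_gt0.
- by rewrite dotZr mulr_gt0.
- split; last by rewrite dotZr mulr_ge0// ltW.
  rewrite (_ : dot _ _ = p * dot (rot s) (x - f)) ?mulr_ge0 ?(ltW p0)//.
  by rewrite !dotE /rot !(mxE, vec2E) /=; ring.
Qed.

Lemma dot_Z2 x y : Z2 x -> Z2 y -> dot x y \is a Num.int.
Proof.
move=> /Z2P[m [n ->]] yZ; have [h ->] := @dot_normal_Z2 R m n y yZ.
exact: intr_int.
Qed.

Lemma Z2_rot x : Z2 x -> Z2 (rot x).
Proof.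
by move=> /Z2P[m [n ->]]; exact: Z2_rot_normal.
Qed.

Lemma int_ge1 (n : R) : n \is a Num.int -> 0 < n -> 1 <= n.
Proof. by move=> /intrP[m ->]; rewrite ltr0z ler1z; lia. Qed.

(** Integrality makes w.s and w.t at least 1, while w.(x - f) < 1, so Cramer's rule bounds the sum
    of both coordinates by the determinant. *)
Lemma edge_bound f s t (a b c : int) x : Z2 s -> Z2 t ->
  edge f s t (normal a b) c x ->
  dot (rot s) (x - f) <= dot (rot s) t /\ dot (rot (x - f)) t <= dot (rot s) t.
Proof.
move=> sZ tZ ed; have D0 := edge_det_gt0 ed; have N2 := edge_ge0 ed.
case: ed => [/andP[cf fc] ws wt [xZ wx] [N1 _]].
have wZ : Z2 (normal a b : 'rV[R]_2) by apply: Z2_vec2.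
have ws1 := int_ge1 (dot_Z2 wZ sZ) ws; have wt1 := int_ge1 (dot_Z2 wZ tZ) wt.
have := cramer s t (x - f) (normal a b).
have : dot (rot s) t * dot (normal a b) (x - f) <= dot (rot s) t * 1.
  by rewrite ler_pM2l// dotBr wx; lra.
have : dot (rot (x - f)) t * 1 <= dot (rot (x - f)) t * dot (normal a b) s.
  exact: ler_wpM2l.
have : dot (rot s) (x - f) * 1 <= dot (rot s) (x - f) * dot (normal a b) t.
  exact: ler_wpM2l.
by split; lra.
Qed.

(** Otherwise the open half-plane above the level of [x] would contain [S], hence its hull, hence
    [x] itself. *)
Lemma conv_hull_dot_le S l x : conv_hull S x ->
  exists2 s, S s & dot l s <= dot l x.
Proof.
move=> Sx; apply: contrapT => none.
suff h : conv_hull S `<=` [set z | dot l x < dot l z].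
  by have := h x Sx; rewrite /= ltxx.
apply: smallest_sub => [|s Ss /=]; last first.
  by rewrite ltNge; apply/negP => sx; apply: none; exists s.
apply/convex_setP => y z t /= hy hz /andP[t0 t1]; rewrite !dotlin.
have [->|tn0] := eqVneq t 0; first by lra.
have : 0 < t * (dot l y - dot l x).
  by rewrite mulr_gt0 ?subr_gt0// lt_neqAle eq_sym tn0.
have : 0 <= (1 - t) * (dot l z - dot l x) by rewrite mulr_ge0; lra.
lra.
Qed.

Lemma convex_polyF f n (B : 'M[R]_(n, 2)) i : convex_set (polyF f B i).
Proof.
apply/convex_setP => x y t [xM xF] [yM yF] t01; split.
  by have /convex_setP := @convex_polyM R f n B; apply.
move: xF yF; rewrite /= !dotlin => xF yF.
have -> : dot (row i B) x = dot (row i B) f + 1 by lra.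
have -> : dot (row i B) y = dot (row i B) f + 1 by lra.
ring.
Qed.

Lemma case_b_orthogonal f w c k (r : 'I_k -> 'rV[R]_2) (B : 'M[R]_(3, 2)) :
  polyM f B = [set x | c%:~R <= dot w x <= c%:~R + 1] -> in_split f w c ->
  case_b f r B -> exists j, dot w (r j) = 0.
Proof.
move=> BE /andP[cf fc] [j rc]; exists j; apply/eqP; apply: contraT => p0.
have fB : polyM f B f by rewrite BE /=; lra.
have n0 : 0 < `|dot w (r j)| by rewrite normr_gt0.
(* The split has width 1 in w, so a change of level by 2 leaves it. *)
have := rc f (2 / `|dot w (r j)|) fB; rewrite divr_ge0 ?ltW// => /(_ isT).
rewrite BE /= !dotlin; have [p|p] := ltP 0 (dot w (r j)).
  by rewrite gtr0_norm// mulfVK//; lra.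
by rewrite ler0_norm// invrN mulrN mulNr mulfVK//; lra.
Qed.

Section HullEdges.
Variables (f w : 'rV[R]_2) (c : int) (k : nat) (r : 'I_k -> 'rV[R]_2).
Variable B : 'M[R]_(3, 2).
Hypothesis BE : polyM f B = [set x | c%:~R <= dot w x <= c%:~R + 1].
Hypotheses (fs : in_split f w c) (ww : 0 < dot w w).
Let S := ray_points f r B `&` polyF f B ord0.

(** Row [ord0] vanishes on [rot w], so it is a multiple of w, nonzero once the facet has a point. *)
Lemma polyF_level x y : polyF f B ord0 x -> polyF f B ord0 y ->
  dot w x = dot w y.
Proof.
have b0 : dot (row ord0 B) (rot w) = 0.
  by apply: split_matrices_rot BE fs _ _; rewrite dot_rotr dot_rotl oppr0.
have lev z : polyF f B ord0 z ->
    dot w w = dot (row ord0 B) w * dot w (z - f).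
  move=> [_ /= zF]; rewrite -[LHS]mulr1 -zF.
  transitivity (dot (row ord0 B) w * dot w (z - f)
    + dot (row ord0 B) (rot w) * dot (rot w) (z - f)).
    by rewrite !dotE /rot !vec2E; ring.
  by rewrite b0 mul0r addr0.
move=> /lev hx /lev hy; have bw : dot (row ord0 B) w != 0.
  by apply: contraTneq ww => b1; rewrite hx b1 mul0r ltxx.
have /(mulfI bw) : dot (row ord0 B) w * dot w (x - f)
  = dot (row ord0 B) w * dot w (y - f) by rewrite -hx -hy.
by rewrite !dotBr; lra.
Qed.

Lemma conv_hull_polyF x : conv_hull S x -> polyF f B ord0 x.
Proof. by apply: smallest_sub; [exact: convex_polyF|move=> y []]. Qed.

(** Along [rot w], some hit lies at or before [x] and another at or beyond [x + n *: rot w]. Their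
    rays span a cone containing the segment from [x] to [x + rot w]. *)
Lemma hull_edge x (n : R) : 1 <= n -> conv_hull S x ->
  conv_hull S (x + n *: rot w) -> Z2 x -> dot w x = c%:~R + 1 ->
  exists i j, edge f (r i) (r j) w c x.
Proof.
move=> n1 xS yS xZ wx.
have hit s : S s -> exists j, [/\ 0 < dot w (r j), 0 < psi B (r j),
    r j = psi B (r j) *: (s - f) & dot w (s - f) = dot w (x - f)].
  move=> [[j psi0 <-] sF].
  have wsf : dot w (f + (psi B (r j))^-1 *: r j) = dot w x.
    by apply: polyF_level sF _; apply: conv_hull_polyF.
  exists j; rewrite addrC addKr scalerA mulfV ?scale1r ?gt_eqF//; split=> //.
    move: wsf; rewrite dotDr dotZr => wsf.
    rewrite -(pmulr_rgt0 _ (_ : 0 < (psi B (r j))^-1)) ?invr_gt0//.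
    by have /andP[? ?] := fs; lra.
  by move: wsf; rewrite dotDr dotBr; lra.
have be0 : 0 < dot w (x - f) by rewrite dotBr wx; have /andP[? ?] := fs; lra.
(* For two vectors of equal level, the determinant is, up to |w|^2, that level times their
   displacement along [rot w]. *)
have turn (u v : 'rV[R]_2) :
    dot w w * dot (rot u) v = dot w u * dot (rot w) v - dot (rot w) u * dot w v.
  by rewrite !dotE /rot !vec2E; ring.
have [s Ss sx] := conv_hull_dot_le (rot w) xS.
have [s' Ss' sy] := conv_hull_dot_le (- rot w) yS.
have [i [wi psi0 ri ws]] := hit s Ss; have [j [wj psj0 rj ws']] := hit s' Ss'.
exists i, j; split=> //; split.
  rewrite ri.
  rewrite (_ : dot _ _ = psi B (r i) * dot (rot (s - f)) (x - f)); last first.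
    by rewrite !dotE /rot !(mxE, vec2E) /=; ring.
  rewrite mulr_ge0 ?(ltW psi0)// -(pmulr_rge0 _ ww) turn ws.
  rewrite mulrC -mulrBl mulr_ge0 ?(ltW be0)// !dotBr; lra.
rewrite rj dotZr mulr_ge0 ?(ltW psj0)// -(pmulr_rge0 _ ww) turn ws'.
have -> : dot w (x + rot w - f) = dot w (x - f).
  by rewrite !dotlin dot_rotr dot_rotl; ring.
rewrite mulrC -mulrBl mulr_ge0 ?(ltW be0)//.
move: sy; rewrite !dotlin !dot_rot => sy.
have : 1 * dot w w <= n * dot w w by rewrite ler_pM2r.
by rewrite mul1r; lra.
Qed.

End HullEdges.

(** The edge starts at whichever lattice point comes first along [rot w]. *)
Lemma case_c_edge_level f (a b c : int) k (r : 'I_k -> 'rV[R]_2)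
    (B : 'M[R]_(3, 2)) x y :
  let w := normal a b in
  let S := ray_points f r B `&` polyF f B ord0 in
  polyM f B = [set x | c%:~R <= dot w x <= c%:~R + 1] ->
  coprimez a b -> in_split f w c -> conv_hull S x -> conv_hull S y ->
  Z2 x -> Z2 y -> x <> y -> dot w x = c%:~R + 1 ->
  exists i j z, edge f (r i) (r j) w c z.
Proof.
move=> w S BE ab fs xS yS xZ yZ xy wx; have ww := @normal_neq0 R a b ab.
have wy : dot w y = dot w x.
  by apply: (polyF_level BE fs ww); apply: conv_hull_polyF; eassumption.
have [n yE] := lattice_line ab yZ xZ wy.
have [n0|n0|n0] := ltgtP n 0.
- have xE : x = y + (- n)%:~R *: rot w.
    by rewrite yE rmorphN scaleNr addrK.
  have n1 : 1 <= (- n)%:~R :> R by rewrite ler1z; lia.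
  rewrite wx in wy; rewrite xE in xS.
  by have [i [j ed]] := hull_edge BE fs ww n1 yS xS yZ wy; exists i, j, y.
- have n1 : 1 <= n%:~R :> R by rewrite ler1z; lia.
  rewrite yE in yS.
  by have [i [j ed]] := hull_edge BE fs ww n1 xS yS xZ wx; exists i, j, x.
- by case: xy; rewrite yE n0 scale0r addr0.
Qed.

(** The lattice points of the facet have level c or c + 1; for level c the normal is reversed. *)
Lemma case_c_edge f (a b c : int) k (r : 'I_k -> 'rV[R]_2) (B : 'M[R]_(3, 2)) :
  polyM f B = [set x | c%:~R <= dot (normal a b) x <= c%:~R + 1] ->
  coprimez a b -> in_split f (normal a b) c -> case_c f r B ->
  exists a' b' c' : int, [/\ coprimez a' b', in_split f (normal a' b') c',
    (forall x, psi_split f (normal a' b') c' x = psi_split f (normal a b) c x) &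
    exists i j z, edge f (r i) (r j) (normal a' b') c' z].
Proof.
move=> BE ab fs /pcard_leP[h].
have [xS xZ] : (conv_hull (ray_points f r B `&` polyF f B ord0) `&` Z2) (h 0%N).
  exact: funS.
have [yS yZ] : (conv_hull (ray_points f r B `&` polyF f B ord0) `&` Z2) (h 1%N).
  exact: funS.
have xy : h 0%N <> h 1%N.
  by move=> e; have := @inj _ _ _ h 0%N 1%N; rewrite !in_setE => /(_ isT isT e).
have [xM _] := conv_hull_polyF xS.
move: (xM); rewrite BE /=; have [n wx] := dot_normal_Z2 a b xZ.
rewrite wx -intrD1 !ler_int => /andP[cn nc].
have [nE|nE] : n = c + 1 \/ n = c by lia.
  exists a, b, c; split=> //; rewrite nE rmorphD/= in wx.
  exact: case_c_edge_level xS yS xZ yZ xy wx.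
have nfs : in_split f (normal (- a) (- b)) (- c - 1).
  by rewrite normalN in_splitN.
exists (- a), (- b), (- c - 1); split=> //.
- by rewrite coprimezN coprimeNz.
- by move=> x; rewrite normalN psi_splitN.
apply: case_c_edge_level xS yS xZ yZ xy _ => //.
- rewrite BE; apply/seteqP; split=> x /=;
    by rewrite normalN dotNl rmorphB rmorphN/= => /andP[? ?];
      apply/andP; split; lra.
- by rewrite coprimezN coprimeNz.
- by rewrite normalN dotNl wx nE rmorphB rmorphN/=; lra.
Qed.

(** A point strictly before the exit of the ray has level strictly between c and c + 1. *)
Lemma split_no_lattice_before f (a b c : int) r (m : R) :
  in_split f (normal a b) c -> psi_split f (normal a b) c r < m -> 0 < m ->
  ~ Z2 (f + m^-1 *: r).
Proof.
move=> /andP[cf fc] lt_m m0 /(dot_normal_Z2 a b)[n].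
rewrite dotDr dotZr; move: lt_m; rewrite /psi_split gt_max.
rewrite !ltr_pdivrMr ?subr_gt0// -!ltr_pdivrMl// mulrN => /andP[h1 h2] e.
have : c%:~R < n%:~R :> R by lra.
have : n%:~R < (c + 1)%:~R :> R by rewrite rmorphD/=; lra.
by rewrite !ltr_int; lia.
Qed.

Section Encoding.
Variables (f : 'rV[R]_2) (k : nat) (r : 'I_k -> 'rV[R]_2).
Variables (Q : nat) (q : 'I_k -> R) (L : nat).
Hypotheses (Q0 : (0 < Q)%N) (QZ : Z2 (Q%:R *: f)).
Hypotheses (q0 : forall j, 0 < q j) (qZ : forall j, Z2 (q j *: r j)).
Hypothesis (r0 : forall j, r j != 0).
Hypothesis QL : forall i j,
  Q%:R * dot (rot (q i *: r i)) (q j *: r j) <= 2 ^+ L.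

Let tags : Type := option ('I_k + 'I_k * 'I_k * 'I_L.+2 * 'I_L.+2)%type.

(* [None] stands for case a, [inl] for case b and [inr] for case c, where the
   last two components are the dyadic classes of the cone coordinates. *)
Definition tagged (g : 'rV[R]_k) (T : tags) := exists a b c : int,
  [/\ coprimez a b, in_split f (normal a b) c,
      g = \row_j psi_split f (normal a b) c (r j) &
      match T with
      | None => forall j, dot (normal a b) (r j) != 0 /\
          Z2 (f + (psi_split f (normal a b) c (r j))^-1 *: r j)
      | Some (inl j) => dot (normal a b) (r j) = 0
      | Some (inr (i, j, m, n)) => exists x,
          [/\ edge f (q i *: r i) (q j *: r j) (normal a b) c x,
              dyadic_class (Q%:R * dot (rot (q i *: r i)) (x - f)) = m &
              dyadic_class (Q%:R * dot (rot (x - f)) (q j *: r j)) = n]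
      end].

Lemma dyadic_edge_int i j x : Z2 x ->
  Q%:R * dot (rot (q i *: r i)) (x - f) \is a Num.int /\
  Q%:R * dot (rot (x - f)) (q j *: r j) \is a Num.int.
Proof.
move=> xZ; have QxZ : Z2 (Q%:R *: (x - f)).
  rewrite scalerBr; apply: Z2B => //.
  move: xZ => /Z2P[m [p ->]]; apply/Z2P; exists (Q%:Z * m), (Q%:Z * p).
  by apply: rV2P; rewrite !mxE/= rmorphM.
split; first by rewrite -dotZr; apply: dot_Z2 => //; exact: Z2_rot.
rewrite (_ : _ * _ = dot (rot (Q%:R *: (x - f))) (q j *: r j)).
  by apply: dot_Z2 => //; exact: Z2_rot.
by rewrite !dotE /rot !(mxE, vec2E) /=; ring.
Qed.

Lemma tagged_inj g g' T : tagged g T -> tagged g' T -> g = g'.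
Proof.
have Q1 : 0 < Q%:R :> R by rewrite ltr0n.
move=> [a [b [c [ab fs -> tT]]]] [a' [b' [c' [ab' fs' -> tT']]]].
case: T tT tT' => [[j wr wr'|[[[i j] m] n] [x [ed xm xn]] [x' [ed' xm' xn']]]|].
- apply/rowP => i; rewrite !mxE; apply: psi_split_collinear => //.
  have rr : 0 < dot (r j) (r j).
    rewrite dotE -!expr2 lt_neqAle addr_ge0 ?sqr_ge0// andbT eq_sym.
    rewrite paddr_eq0 ?sqr_ge0// !sqrf_eq0.
    apply/negP => /andP[/eqP z0 /eqP z1].
    by have /eqP := r0 j; apply; apply: rV2P; rewrite mxE.
  apply: (mulIf (lt0r_neq0 rr)); rewrite mul0r.
  transitivity (dot (normal a b) (rot (r j)) * dot (normal a' b') (r j)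
      - dot (normal a b) (r j) * dot (normal a' b') (rot (r j))).
    by rewrite !dotE /rot !vec2E; ring.
  by rewrite wr wr'; ring.
- apply/rowP => l; rewrite !mxE; apply: psi_split_collinear => //.
  have [_ _ _ [xZ _] [N1 _]] := ed; have N2 := edge_ge0 ed.
  have [_ _ _ [xZ' _] [N1' _]] := ed'; have N2' := edge_ge0 ed'.
  have [I1 I2] := dyadic_edge_int i j xZ.
  have [I1' I2'] := dyadic_edge_int i j xZ'.
  have QN1 := mulr_ge0 (ltW Q1) N1; have QN2 := mulr_ge0 (ltW Q1) N2.
  have QN1' := mulr_ge0 (ltW Q1) N1'; have QN2' := mulr_ge0 (ltW Q1) N2'.
  by apply: (edge_uniq ed ed'); rewrite -(ler_pM2l Q1) mulrCA;
    apply: dyadic_class_le => //; rewrite ?xm ?xn ?xm' ?xn'.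
- move=> h h'; apply/rowP => j; rewrite !mxE.
  have [p0 xZ] := h j; have [p0' xZ'] := h' j.
  (* Were the gauges different, the lattice hit of the larger one would be interior to the other
     split. *)
  apply/eqP; rewrite eq_le; apply/andP; split; rewrite leNgt; apply/negP => lt.
    by apply: split_no_lattice_before fs' lt (psi_split_gt0 fs p0) xZ.
  by apply: split_no_lattice_before fs lt (psi_split_gt0 fs' p0') xZ'.
Qed.

Lemma Xi0_tagged g : Xi0 f r g -> exists T, tagged g T.
Proof.
move=> [B [/split_matricesP[a [b [c [ab fs BE psiE]]]] exc] <-].
have gE : gamma r B = \row_j psi_split f (normal a b) c (r j).
  by apply/rowP => j; rewrite !mxE psiE.
(* Orthogonal rays are split off first, so that afterwards every ray has positive gauge and
   contributes a point to P(B,R). *)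
have [[j wr]|nob] := pselect (exists j, dot (normal a b) (r j) = 0).
  by exists (Some (inl j)), a, b, c.
case: exc => [ca|cb|cc].
- exists None, a, b, c; split=> // j.
  have p0 : dot (normal a b) (r j) != 0.
    by apply/eqP => wr; apply: nob; exists j.
  split=> //; rewrite -psiE; apply: ca; exists j => //=.
  by rewrite psiE; exact: psi_split_gt0.
- by case: nob; exact: case_b_orthogonal BE fs cb.
have [a' [b' [c' [ab' fs' psiE' [i [j [x ed]]]]]]] := case_c_edge BE ab fs cc.
have {}ed := edge_scale (q0 i) (q0 j) ed.
have [_ _ _ [xZ _] _] := ed.
have [b1 b2] := edge_bound (qZ i) (qZ j) ed.
have bound (N : R) : N <= dot (rot (q i *: r i)) (q j *: r j) ->
    (dyadic_class (Q%:R * N) < L.+2)%N.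
  move=> hN; apply: dyadic_class_lt.
  by apply: le_trans (QL i j); rewrite ler_wpM2l.
exists (Some (inr (i, j, Ordinal (bound _ b1), Ordinal (bound _ b2)))).
exists a', b', c'.
split=> //; last by exists x.
by rewrite gE; apply/rowP => l; rewrite !mxE psiE'.
Qed.

Lemma card_Xi0 : Xi0 f r #<= `I_((k + k * k * L.+2 * L.+2).+1).
Proof.
have := card_le_tags Xi0_tagged (fun g g' T => @tagged_inj g g' T).
by rewrite card_option card_sum !card_prod !card_ord.
Qed.

End Encoding.
End Exceptional.

(** * Encoding sizes and the polynomial bound *)

Section BinarySizes.
Context {R : realType}.

Definition denv (v : 'rV[rat]_2) : nat :=
  `|denq (v ord0 ord0)|%N * `|denq (v ord0 ord_max)|%N.

Lemma denv_gt0 v : (0 < denv v)%N.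
Proof. by rewrite muln_gt0 !absz_gt0 !denq_neq0. Qed.

Lemma vec_sizeE v :
  vec_size v = (2 + (rat_size (v ord0 ord0) + rat_size (v ord0 ord_max)))%N.
Proof.
rewrite /vec_size big_ord_recl big_ord1.
by congr (_ + (_ + rat_size (v _ _)))%N; apply/val_inj.
Qed.

Lemma absz_le_up_log (z : int) : (`|z| <= 2 ^ up_log 2 `|z|.+1)%N.
Proof. by apply: leq_trans (up_logP _ _). Qed.

Lemma ratr_den (x : rat) : (`|denq x|%N)%:R * ratr x = (numq x)%:~R :> R.
Proof.
rewrite pmulrn absz_denq /ratr mulrCA divff ?mulr1//.
by rewrite intr_eq0 denq_neq0.
Qed.

Lemma denv_scale v : exists m n : int,
  [/\ (denv v)%:R *: map_mx ratr v = vec2 m%:~R n%:~R :> 'rV[R]_2,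
      (`|m| <= 2 ^ vec_size v)%N, (`|n| <= 2 ^ vec_size v)%N &
      (denv v <= 2 ^ vec_size v)%N].
Proof.
set x := v ord0 ord0; set y := v ord0 ord_max.
have bd (z z' : rat) (m n : nat) : (m <= 2 ^ up_log 2 `|numq z|%N.+1)%N \/
    (m <= 2 ^ up_log 2 `|denq z|%N.+1)%N ->
    (n <= 2 ^ up_log 2 `|numq z'|%N.+1)%N \/
    (n <= 2 ^ up_log 2 `|denq z'|%N.+1)%N ->
    (m * n <= 2 ^ (2 + (rat_size z + rat_size z')))%N.
  move=> hm hn; rewrite addnC !expnD -[X in (X <= _)%N]muln1.
  rewrite leq_mul// leq_mul// /rat_size.
    by case: hm => /leq_trans; apply; rewrite -!expnD leq_exp2l//; lia.
  by case: hn => /leq_trans; apply; rewrite -!expnD leq_exp2l//; lia.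
exists (numq x * `|denq y|%N), (numq y * `|denq x|%N); split.
- apply: rV2P; rewrite !mxE/= /denv -/x -/y natrM rmorphM/= -ratr_den; ring.
- rewrite abszM absz_nat vec_sizeE.
  by apply: bd; [left|right]; exact: absz_le_up_log.
- rewrite abszM absz_nat vec_sizeE mulnC.
  by apply: bd; [right|left]; exact: absz_le_up_log.
- by rewrite vec_sizeE; apply: bd; right; exact: absz_le_up_log.
Qed.

End BinarySizes.

(** The determinant is a sum of two terms of size at most 2^(2q), which costs one extra factor 2,
    and [Q] contributes 2^q. *)
Lemma det_bound (R : realType) (a b c d : int) (p q m n Q : nat) :
  (`|a| <= 2 ^ m)%N -> (`|b| <= 2 ^ m)%N -> (`|c| <= 2 ^ n)%N ->
  (`|d| <= 2 ^ n)%N -> (Q <= 2 ^ p)%N -> (p <= q)%N -> (m <= q)%N ->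
  (n <= q)%N ->
  Q%:R * dot (rot (vec2 a%:~R b%:~R)) (vec2 c%:~R d%:~R)
    <= 2 ^+ (3 * q).+1 :> R.
Proof.
move=> ha hb hc hd hQ pq mq nq.
have e2 i : (i <= q)%N -> (2 ^ i <= 2 ^ q)%N by move=> ?; rewrite leq_exp2l.
have h : (Q * (`|a| * `|d| + `|b| * `|c|) <= 2 ^ (3 * q).+1)%N.
  rewrite expnS mulnC expnM.
  rewrite (_ : (2 ^ 3) ^ q = 2 ^ q * (2 ^ q * 2 ^ q))%N; last first.
    by rewrite -!expnD -expnM; congr (2 ^ _)%N; lia.
  rewrite mulnCA mulnC leq_mul//; first by rewrite (leq_trans hQ) ?e2.
  rewrite mul2n -addnn leq_add// leq_mul//.
  - exact: leq_trans ha (e2 _ _).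
  - exact: leq_trans hd (e2 _ _).
  - exact: leq_trans hb (e2 _ _).
  - exact: leq_trans hc (e2 _ _).
rewrite dotE /rot !vec2E.
apply: (@le_trans _ _ (Q * (`|a| * `|d| + `|b| * `|c|))%:R); last first.
  by rewrite -natrX ler_nat.
rewrite natrM ler_wpM2l// natrD !natrM !natr_absz !intr_norm addrC mulNr.
rewrite lerD// -?normrM ?ler_norm// -normrN ler_norm//.
Qed.

Theorem proposition3p14 (R : realType) :
  exists p : {poly nat},
  forall (f : 'rV[rat]_2) (k : nat) (r : 'I_k -> 'rV[rat]_2),
  (forall j, r j != 0) ->
  let fR : 'rV[R]_2 := map_mx ratr f in
  let rR : 'I_k -> 'rV[R]_2 := fun j => map_mx ratr (r j) in
  [/\ Xi0 fR rR `<=` Pi fR rR,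
      finite_set (Xi0 fR rR),
      forall g, (Pi fR rR `\` Xi0 fR rR) g ->
        exists g1 g2, [/\ Delta fR rR g1, Delta fR rR g2 &
                          strict_convex_combination g g1 g2]
    & Xi0 fR rR #<= `I_(p.[data_size f r])].
Proof.
(* [l] evaluates to 3 s + 3, the number L + 2 of dyadic classes for L = 3 s + 1. *)
pose l : {poly nat} := (3%N)%:P * 'X + (3%N)%:P.
exists (1 + 'X + 'X * 'X * l * l) => f k r r0 fR rR.
set s := data_size f r.
have fs : (vec_size f <= s)%N by rewrite leq_addr.
have rs j : (vec_size (r j) <= s)%N.
  by rewrite /s /data_size (bigD1 j)//= addnCA leq_addr.
(* Every vector has positive size, so the data size bounds the number of rays. *)
have ks : (k <= s)%N.
  apply: (@leq_trans (\sum_(j < k) vec_size (r j)))%N; last exact: leq_addl.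
  rewrite -[X in (X <= _)%N]card_ord -sum1_card; apply: leq_sum => j _.
  by rewrite /vec_size.
have r0R j : rR j != 0 by rewrite map_mx_eq0.
have dZ (v : 'rV[rat]_2) : Z2 ((denv v)%:R *: (map_mx ratr v : 'rV[R]_2)).
  by have [m [n [-> _ _ _]]] := @denv_scale R v; exact: Z2_vec2.
have q0 j : 0 < (denv (r j))%:R :> R by rewrite ltr0n denv_gt0.
have QL i j : (denv f)%:R * dot (rot ((denv (r i))%:R *: rR i))
    ((denv (r j))%:R *: rR j) <= 2 ^+ (3 * s).+1.
  have [m [n [-> hm hn _]]] := @denv_scale R (r i).
  have [m' [n' [-> hm' hn' _]]] := @denv_scale R (r j).
  have [_ [_ [_ _ _ hQ]]] := @denv_scale R f.
  exact: det_bound hm hn hm' hn' hQ fs (rs i) (rs j).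
have card : Xi0 fR rR #<= `I_((k + k * k * (3 * s).+3 * (3 * s).+3).+1).
  exact: (card_Xi0 (denv_gt0 f) (dZ f) q0 (fun j => dZ (r j)) r0R QL).
split.
- by move=> g [B [BS _] <-]; exists B.
- exact: card_le_finite card (finite_II _).
- by move=> g; exact: Pi_decomposition.
- apply: card_le_trans card _; rewrite card_le_II !(hornerE, hornerD, hornerM).
  suff : ((k + k * k * (3 * s).+3 * (3 * s).+3).+1
    <= 1 + s + s * s * (3 * s + 3) * (3 * s + 3))%N by [].
  by rewrite -addn3 -addn1 addnC addnA leq_add ?leq_add// !leq_mul.
Qed.
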